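(* Let $k>1$ be a natural number and let $G=(X,Y)$ be a bipartite graph of order $n$ with $\delta(G)\ge k$. Then $$\gamma_{t}(G) \le n\left(1- \frac{k!}{\prod_{i=0}^{k-1}\left(\frac{k}{k-1}+i\right)}\right).$$
   Context: All graphs are finite and simple (no loops, no multiple edges). The order of a graph is its number of vertices, and $\delta(G)$ denotes the minimum degree of $G$. Here $X$ and $Y$ are the two parts of the bipartite graph $G$; they need not have equal size. A total dominating set of a graph $G$ is a set $S\subseteq V(G)$ such that every vertex of $G$ (including the vertices of $S$) is adjacent to at least one vertex of $S$. The total domination number $\gamma_t(G)$ is the minimum cardinality of a total dominating set of $G$. *)

(* Defs.v *)
From mathcomp Require Import all_boot all_order all_algebra.

Set Implicit Arguments.
Unset Strict Implicit.
Unset Printing Implicit Defensive.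

Record sgraph := SGraph {
  svertex :> finType;
  sedge : rel svertex;
  sedge_sym : symmetric sedge;
  sedge_irrefl : irreflexive sedge
}.

Definition degree (G : sgraph) (v : G) : nat := #|[set w | sedge v w]|.

(* Degrees are smaller than the order, so the default value #|G| matters only
   for the graph without vertices, whose minimum degree is then 0. *)
Definition min_degree (G : sgraph) : nat :=
  \big[minn/#|G|]_(v : G) degree v.

Definition bipartition (G : sgraph) (X Y : {set G}) : Prop :=
  [/\ X :|: Y = [set: G], [disjoint X & Y] &
      forall u v : G, sedge u v ->
        (u \in X) && (v \in Y) || (u \in Y) && (v \in X)].

Definition total_dominating (G : sgraph) (S : {set G}) : bool :=
  [forall v : G, exists w in S, sedge v w].

(* Every set has at most #|G| elements, so the default value #|G| matters only
   when there is no total dominating set, i.e. when some vertex is isolated. *)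
Definition total_domination_number (G : sgraph) : nat :=
  \big[minn/#|G|]_(S : {set G} | total_dominating S) #|S|.

(* Main.v *)
(** Choosing [k] neighbours of each vertex gives a [k]-uniform hypergraph with
    [n] edges on the [n] vertices of [G], and every set meeting all its edges is
    total dominating.  With [f d = \prod_(1 <= i <= d) i (k-1) / (i (k-1) + 1)],
    such a set [S] with [|S| <= \sum_v (1 - f (deg v))] (the Caro-Tuza bound) is
    obtained greedily: put a vertex of maximum degree [D] in [S] and delete its
    [D] edges.  The other vertices lose [D (k-1)] incidences, and, [f] being
    convex, each one increases [\sum_v f (deg v)] by at least
    [f (D-1) - f D = f D / (D (k-1))], so these increases make up for [f D].
    The average degree being [k], convexity of [f] also gives
    [\sum_v f (deg v) >= n f k]. *)
Require Import Defs.
From mathcomp Require Import all_boot all_order all_algebra.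
From mathcomp Require Import ring lra.

Import Order.TTheory GRing.Theory Num.Theory.
Local Open Scope ring_scope.

Section Weight.
Variables (R : realFieldType) (a : R).
Hypothesis a_gt1 : 1 < a.

(* For [a = k / (k - 1)] the [i]-th factor, counting from [1], is
   [i (k-1) / (i (k-1) + 1)]. *)
Definition caro_weight (d : nat) : R := \prod_(0 <= i < d) (i.+1%:R / (a + i%:R)).

Definition caro_drop (d : nat) : R := caro_weight d - caro_weight d.+1.

Lemma caro_weight0 : caro_weight 0 = 1.
Proof. by rewrite /caro_weight big_geq. Qed.

Lemma caro_weightS d :
  caro_weight d.+1 = caro_weight d * (d.+1%:R / (a + d%:R)).
Proof. by rewrite /caro_weight big_nat_recr. Qed.

Lemma caro_weight_den_gt0 d : 0 < a + d%:R.
Proof. by have := ler0n R d; move: a_gt1; lra. Qed.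

Lemma caro_weight_gt0 d : 0 < caro_weight d.
Proof.
by apply: prodr_gt0 => i _; rewrite divr_gt0 ?ltr0Sn ?caro_weight_den_gt0.
Qed.

Lemma caro_dropE d : caro_drop d = caro_weight d * ((a - 1) / (a + d%:R)).
Proof.
rewrite /caro_drop caro_weightS -natr1.
have := lt0r_neq0 (caro_weight_den_gt0 d); set w := caro_weight d.
by move=> ne0; field.
Qed.

(** For [a = k / (k - 1)] one has [(a - 1) * (k - 1) = 1], so [D * (k - 1)] drops at [D - 1] amount
    to exactly the weight at [D]. *)
Lemma caro_drop_weightS d : d.+1%:R * caro_drop d = (a - 1) * caro_weight d.+1.
Proof. by rewrite caro_dropE caro_weightS; ring. Qed.

Lemma caro_drop_ge0 d : 0 <= caro_drop d.
Proof.
rewrite caro_dropE mulr_ge0 ?(ltW (caro_weight_gt0 d)) //.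
by rewrite divr_ge0 ?(ltW (caro_weight_den_gt0 d)) ?subr_ge0 ?ltW.
Qed.

(** This is convexity of [caro_weight]: both factors in [caro_dropE] decrease with [d]. *)
Lemma caro_dropS d : caro_drop d.+1 <= caro_drop d.
Proof.
rewrite !caro_dropE ler_pM ?(ltW (caro_weight_gt0 _)) //.
- by rewrite divr_ge0 ?(ltW (caro_weight_den_gt0 _)) ?subr_ge0 ?ltW.
- by rewrite -subr_ge0 caro_drop_ge0.
rewrite ler_pM2l ?subr_gt0 // lef_pV2 ?posrE ?caro_weight_den_gt0 //.
by rewrite lerD2l ler_nat.
Qed.

Lemma caro_drop_le m d : (m <= d)%N -> caro_drop d <= caro_drop m.
Proof.
move=> /subnKC <-; elim: (d - m)%N => [|r IHr]; first by rewrite addn0.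
by rewrite addnS (le_trans (caro_dropS _)).
Qed.

(** The right side telescopes into [r] drops at indices at most [d], each at least [caro_drop d]. *)
Lemma caro_weight_decr_ge m r d : (m + r <= d.+1)%N ->
  r%:R * caro_drop d <= caro_weight m - caro_weight (m + r).
Proof.
elim: r => [|r IHr]; first by rewrite mul0r addn0 subrr.
rewrite addnS ltnS => le_d.
have := IHr (leqW le_d); have := caro_drop_le _ _ le_d.
by rewrite {2}/caro_drop -natr1 mulrDl mul1r; lra.
Qed.

Lemma caro_weight_decr_le m r :
  caro_weight m - caro_weight (m + r) <= r%:R * caro_drop m.
Proof.
elim: r => [|r IHr]; first by rewrite mul0r addn0 subrr.
have := IHr; have := caro_drop_le _ _ (leq_addr r m).
by rewrite {1}/caro_drop addnS -natr1 mulrDl mul1r; lra.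
Qed.

(** By convexity, the line through the points of the graph at [k] and [k + 1] lies below it at every
    natural number. *)
Lemma caro_weight_tangent k d :
  caro_weight k + (k%:R - d%:R) * caro_drop k <= caro_weight d.
Proof.
have [le_dk|/ltnW le_kd] := leqP d k.
  have := caro_weight_decr_ge d (k - d) k.
  by rewrite subnKC // natrB // => /(_ (leqnSn k)); lra.
have := caro_weight_decr_le k (d - k).
by rewrite subnKC // natrB //; lra.
Qed.

End Weight.

Section Hypergraph.
Variables (T I : finType) (edge : I -> {set T}).

Definition hdegree (E : {set I}) (v : T) : nat := \sum_(e in E) (v \in edge e).

Lemma sum_hdegree E : (\sum_v hdegree E v = \sum_(e in E) #|edge e|)%N.
Proof.
rewrite exchange_big; apply: eq_bigr => e _ /=.
by rewrite -sum1_card [RHS]big_mkcond; apply: eq_bigr => v _; case: ifP.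
Qed.

Variables (R : realFieldType) (k : nat).
Hypotheses (k_gt1 : (1 < k)%N) (edge_card : forall e, #|edge e| = k).

Let a : R := k%:R / (k%:R - 1).

Let k1_gt0 : 0 < k%:R - 1 :> R.
Proof. by rewrite subr_gt0 ltr1n. Qed.

Let a1E : (a - 1) * (k%:R - 1) = 1.
Proof. by have := lt0r_neq0 k1_gt0; rewrite /a => ne0; field. Qed.

Let a_gt1 : 1 < a.
Proof. by rewrite -subr_gt0 -(pmulr_lgt0 _ k1_gt0) a1E. Qed.

Lemma sum_hdegree_uniform E : (\sum_v hdegree E v = #|E| * k)%N.
Proof. by rewrite sum_hdegree (eq_bigr (fun=> k)) ?sum_nat_const. Qed.

Lemma hdegree_gt0 (E : {set I}) e v :
  e \in E -> v \in edge e -> (0 < hdegree E v)%N.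
Proof. by move=> eE ve; rewrite /hdegree (bigD1 e) //= ve. Qed.

(** The weight of [v] rises to 1, the weight of degree 0, and the other vertices together gain at
    least the old weight of [v]. *)
Lemma delete_max_vertex (E : {set I}) v :
    (forall u, hdegree E u <= hdegree E v)%N -> (0 < hdegree E v)%N ->
  1 + \sum_u caro_weight R a (hdegree E u)
    <= \sum_u caro_weight R a (hdegree [set e in E | v \notin edge e] u).
Proof.
move=> vmax; set E' := [set e in E | _]; set f := caro_weight R a.
pose lost := [set e in E | v \in edge e].
have degE u : hdegree E u = (hdegree E' u + hdegree lost u)%N.
  rewrite /hdegree (bigID (fun e => v \in edge e)) /= addnC.
  by congr (_ + _)%N; apply: eq_bigl => e; rewrite inE.
have degE'v : hdegree E' v = 0%N.
  by apply: big1 => e; rewrite inE => /andP[_ /negPf->].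
have degv : hdegree E v = hdegree lost v by rewrite degE degE'v.
have lost_card : #|lost| = hdegree E v.
  rewrite degv /hdegree -sum1_card; apply: eq_bigr => e.
  by rewrite inE => /andP[_ ->].
(* Each deleted edge has [k - 1] vertices besides [v]. *)
have lost_sum : \sum_(u | u != v) (hdegree lost u)%:R
    = (hdegree E v)%:R * (k%:R - 1) :> R.
  have := sum_hdegree_uniform lost; rewrite (bigD1 v) //= -degv.
  rewrite lost_card => /(congr1 (GRing.natmul (1 : R))).
  by rewrite natrD natrM natr_sum; lra.
case D: (hdegree E v) => [//|d] _.
rewrite (bigD1 v) //= [leRHS](bigD1 v) //= degE'v {3}/f caro_weight0 lerD2l.
(* The old weight of [v] is shared among the other vertices in proportion to their lost
   incidences. *)
have: f (hdegree E v) = \sum_(u | u != v) (hdegree lost u)%:R * caro_drop R a d.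
  rewrite -mulr_suml lost_sum D mulrAC caro_drop_weightS //.
  by rewrite mulrAC a1E mul1r.
move=> ->; rewrite -big_split ler_sum //= => u _.
(* Maximality of [v] keeps the old degree of [u] at most [d + 1], so [u] only passes drops at
   indices up to [d]. *)
rewrite -lerBrDr degE caro_weight_decr_ge // -degE -D; exact: vmax.
Qed.

(** Induction on the number of edges, with the vertex set fixed: a vertex in no remaining edge has
    weight 1, which cancels its share of [#|T|]. *)
Theorem caro_tuza (E : {set I}) : exists S : {set T},
  (forall e, e \in E -> exists2 v, v \in S & v \in edge e) /\
  #|S|%:R + \sum_v caro_weight R a (hdegree E v) <= #|T|%:R.
Proof.
have [m leEm] := ubnP #|E|; elim: m E leEm => // m IHm E leEm.
have [->|[e0 e0E]] := set_0Vmem E.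
  exists set0; split=> [e|]; first by rewrite inE.
  rewrite cards0 add0r (eq_bigr (fun=> 1)) ?sumr_const // => v _.
  by rewrite /hdegree big_set0 caro_weight0.
have /card_gt0P[v0 v0e0] : (0 < #|edge e0|)%N by rewrite edge_card ltnW.
have [v _ vmax] := @arg_maxnP _ v0 xpredT (hdegree E) isT.
have D_gt0 : (0 < hdegree E v)%N.
  by rewrite (leq_trans _ (vmax v0 isT)) // (hdegree_gt0 _ _ _ e0E).
have := delete_max_vertex E v (fun u => vmax u isT) D_gt0.
set E' := [set e in E | _] => weightE'.
have ltE' : (#|E'| < #|E|)%N.
  apply/proper_card/properP; split; first by apply/subsetP=> e /setIdP[].
  have [/exists_inP[e eE ve]|noe] := boolP [exists e in E, v \in edge e].
    by exists e; rewrite // inE eE ve.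
  move: D_gt0; rewrite /hdegree big1 // => e eE.
  by move: noe; rewrite negb_exists_in => /forall_inP/(_ e eE)/negPf->.
have [S [hitS cardS]] := IHm E' (leq_trans ltE' leEm).
exists (v |: S); split=> [e eE|].
  have [ve|nve] := boolP (v \in edge e); first by exists v; rewrite ?setU11.
  have [|w wS we] := hitS e; first by rewrite inE eE.
  by exists w; rewrite // in_setU1 wS orbT.
have : (#|v |: S|%:R : R) <= 1 + #|S|%:R.
  by rewrite cardsU1 natrD lerD2r lern1 leq_b1.
by lra.
Qed.

Lemma small_transversal : (#|I| <= #|T|)%N -> exists S : {set T},
  (forall e, exists2 v, v \in S & v \in edge e) /\
  #|S|%:R <= #|T|%:R * (1 - caro_weight R a k).
Proof.
move=> leIT; have [S [hitS cardS]] := caro_tuza [set: I].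
exists S; split=> [e|]; first exact: hitS (in_setT e).
have : \sum_(v : T) (caro_weight R a k
    + (k%:R - (hdegree [set: I] v)%:R) * caro_drop R a k)
    <= \sum_v caro_weight R a (hdegree [set: I] v).
  by apply: ler_sum => v _; apply: caro_weight_tangent.
have degsum : \sum_v (hdegree [set: I] v)%:R = #|I|%:R * k%:R :> R.
  by rewrite -natr_sum sum_hdegree_uniform natrM cardsT.
rewrite big_split /= -mulr_suml sumrB degsum !sumr_const.
rewrite -[caro_weight R a k *+ _]mulr_natl -[k%:R *+ _]mulr_natl.
(* The linear terms of the tangent bounds sum to this; it is nonnegative because the average degree
   is at most [k]. *)
have : 0 <= (#|T|%:R - #|I|%:R) * k%:R * caro_drop R a k.
  by rewrite !mulr_ge0 ?caro_drop_ge0 ?subr_ge0 ?ler_nat.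
by rewrite -/(#|T|); lra.
Qed.

End Hypergraph.

Lemma bigminn_le_cond (T : finType) (P : pred T) (F : T -> nat) (m : nat) (x : T) :
  P x -> (\big[minn/m]_(y | P y) F y <= F x)%N.
Proof. by move=> Px; rewrite -minEnat -leEnat; apply: bigmin_le_cond. Qed.

Lemma set_subset_card (T : finType) (A : {set T}) (k : nat) :
  (k <= #|A|)%N -> exists2 B : {set T}, B \subset A & #|B| = k.
Proof.
move=> leA; exists [set x in take k (enum A)].
  by apply/subsetP=> x; rewrite inE => /mem_take; rewrite mem_enum.
rewrite cardsE (card_uniqP _) ?take_uniq ?enum_uniq // size_takel //.
by rewrite -cardE.
Qed.

Theorem theorem5 (k : nat) (hk : (1 < k)%N)
    (G : sgraph) (X Y : {set G}) (hXY : bipartition X Y)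
    (n : nat) (hn : #|G| = n) (hdeg : (k <= min_degree G)%N) :
  (total_domination_number G)%:R <=
    n%:R * (1 - k`!%:R / \prod_(0 <= i < k) (k%:R / (k%:R - 1) + i%:R)) :> rat.
Proof.
have nbhd v : exists B : {set G}, (B \subset [set w | sedge v w]) && (#|B| == k).
  have [|B sB cB] := @set_subset_card _ [set w | sedge v w] k.
    exact: leq_trans hdeg (bigminn_le_cond _ _ _ _ _ isT).
  by exists B; rewrite sB cB eqxx.
(* Edges are indexed by vertices, so there are exactly [n] of them even if two vertices choose the
   same set. *)
pose edge v : {set G} := xchoose (nbhd v).
have edgeP v := andP (xchooseP (nbhd v)).
have edge_card v : #|edge v| = k by apply/eqP; case: (edgeP v).
have [S [hitS cardS]] := small_transversal _ _ edge rat k hk edge_card (leqnn _).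
have domS : total_dominating S.
  apply/forallP=> v; have [w wS we] := hitS v; apply/exists_inP; exists w => //.
  by have [/subsetP/(_ w we)] := edgeP v; rewrite inE.
rewrite -hn; apply: (@le_trans _ _ #|S|%:R).
  by rewrite ler_nat; apply: bigminn_le_cond.
(* Shifting the index of [k!] by one matches the numerators [i.+1]. *)
by move: cardS; rewrite /caro_weight prodf_div -natr_prod fact_prod big_add1.
Qed.
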